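(* Let $M$ be an inverse monoid generated (as an inverse monoid) by a finite subset $X$, and let $L$ be a closed inverse submonoid of $M$. Consider the following properties of $L$: (a) $L$ is recognized by a finite inverse automaton; (b) $L$ has finite index in $M$; (c) $L$ is a recognizable subset of $M$; (d) $L$ is a rational subset of $M$; (e) $L$ is finitely generated as a closed inverse submonoid of $M$. Then (a), (b) and (c) are equivalent; each of them implies (d); and (d) implies (e). The latter two implications are not reversible: there exist a finitely generated inverse monoid $M$ and a closed inverse submonoid $L$ of $M$ satisfying (d) but not (a), (b), (c); and there exist a finitely generated inverse monoid $M$ and a closed inverse submonoid $L$ of $M$ satisfying (e) but not (d).
   Context: The natural partial order on an inverse semigroup $S$ with idempotent set $E(S)$ is $s\leq t \iff s=et$ for some $e\in E(S)$. A subset $A\subseteq S$ is closed if $a\in A$ and $a\leq s$ imply $s\in A$; the closure of $B\subseteq S$ is $B^{\uparrow}=\{s\in S: s\geq b \text{ for some } b\in B\}$. A closed inverse submonoid is an inverse submonoid (containing the identity of $M$) that is a closed subset. Cosets and index: for a closed inverse submonoid $L$ of $M$, a (right) coset of $L$ is a subset $(Ls)^{\uparrow}$ with $s\in M$ and $ss^{-1}\in L$. The index $[M:L]$ is the cardinality of the set of cosets of $L$; $L$ has finite index if there are finitely many. Automata: let $X^{-1}$ be a disjoint set of formal inverses of the elements of $X$, $A=X\sqcup X^{-1}$ (with $(x^{-1})^{-1}=x$), and let $\theta:A^*\to M$ be the monoid homomorphism sending each $x\in X$ to itself and each formal inverse $x^{-1}$ to the inverse of $x$ in $M$. A (finite deterministic)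 automaton over $A$ consists of a finite set $S$ of states, an initial state $s_0$, a partially defined transition function $S\times A\to S$, $(s,a)\mapsto s\lhd a$, and a set $T\subseteq S$ of final states. The transition function extends to a partial function $(s,w)\mapsto s\lhd w$ for $w\in A^*$. The automaton recognizes the language of all $w\in A^*$ such that $s_0\lhd w$ is defined and lies in $T$. It is an inverse automaton if $s\lhd a=t$ implies $t\lhd a^{-1}=s$ for all $a \in A$ and states $s,t$, and each partial function $s\mapsto s\lhd a$ is injective. A subset $P\subseteq M$ is recognized by an automaton if the language it recognizes is the full preimage $P\theta^{-1}=\{w \in A^* : w\theta\in P\}$. A subset $P\subseteq M$ is recognizable if there exist a finite monoid $N$, a monoid homomorphism $\phi:M\to N$ and a subset $Q\subseteq N$ with $P=Q\phi^{-1}$ (the preimage of $Q$). The rational subsets of $M$ form the smallest collection of subsets of $M$ that contains all finite subsets and is closed under finite unions, products of subsets, and passing from a subset to the submonoid it generates. $L$ is finitely generated as a closed inverse submonoid if there is a finite subset $Y\subseteq L$ such that $L$ is the smallest closed inverse submonoid of $M$ containing $Y$; equivalently, every $\ell\in L$ satisfies $\ell\geq w$ for some (possibly empty) product $w$ of elements of $Y$ and their inverses. *)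

(* Defs.v *)
From HB Require Import structures.
From mathcomp Require Import all_boot.
From mathcomp Require Import boolp classical_sets functions cardinality.

Set Implicit Arguments.
Unset Strict Implicit.
Unset Printing Implicit Defensive.

Local Open Scope classical_set_scope.
Local Open Scope group_scope.

(* The parent is starMonoidType because it is already the join of monoidType  *)
(* and baseGroupType. Its extra laws are redundant here: they follow from the *)
(* three axioms below, as the factory Monoid_isInverseMonoid shows.           *)
HB.mixin Record isInverseMonoid M of StarMonoid M := {
  mulgVg : forall x : M, x * x^-1 * x = x;
  mulVgV : forall x : M, x^-1 * x * x^-1 = x^-1;
  invg_unique : forall x y : M, x * y * x = x -> y * x * y = y -> y = x^-1
}.

#[short(type="inverseMonoidType")]
HB.structure Definition InverseMonoid :=
  {M of isInverseMonoid M & StarMonoid M}.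

HB.factory Record Monoid_isInverseMonoid M of Monoid M := {
  inv : M -> M;
  mulgVg : forall x : M, x * inv x * x = x;
  mulVgV : forall x : M, inv x * x * inv x = inv x;
  invg_unique : forall x y : M, x * y * x = x -> y * x * y = y -> y = inv x
}.

HB.builders Context M of Monoid_isInverseMonoid M.

Fact invK : involutive inv.
Proof. by move=> x; rewrite -(invg_unique (mulVgV x) (mulgVg x)). Qed.

Fact idem_mul (e f : M) : e * e = e -> f * f = f -> e * f * (e * f) = e * f.
Proof.
move=> ee ff; set z := inv (e * f).
have zM : e * f * z * (e * f) = e * f := mulgVg _.
have zV : z * (e * f) * z = z := mulVgV _.
have zE : f * z * e = z.
  apply: invg_unique.
    by rewrite !mulgA -(mulgA e f f) ff -(mulgA _ e e) ee -[RHS]zM !mulgA.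
  rewrite !mulgA -(mulgA _ e e) ee -(mulgA _ f f) ff.
  by rewrite -[in RHS]zV !mulgA.
have zz : z * z = z.
  transitivity (f * (z * (e * f) * z) * e); last by rewrite zV.
  by rewrite -{1}zE -{2}zE !mulgA.
have : z = e * f by rewrite -[RHS]invK -/z; apply: invg_unique; rewrite !zz.
by move=> <-.
Qed.

Fact idem_comm (e f : M) : e * e = e -> f * f = f -> e * f = f * e.
Proof.
move=> ee ff; have efef := idem_mul ee ff; have fefe := idem_mul ff ee.
have -> : f * e = inv (e * f).
  apply: invg_unique.
    by rewrite !mulgA -(mulgA e f f) ff -(mulgA _ e e) ee -!mulgA (mulgA e f).
  by rewrite !mulgA -(mulgA f e e) ee -(mulgA _ f f) ff -!mulgA (mulgA f e).
by apply: invg_unique; rewrite !efef.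
Qed.

Fact invM : {morph inv : x y / x * y >-> y * x}.
Proof.
move=> x y; symmetry; apply: invg_unique.
  have idy : y * inv y * (y * inv y) = y * inv y by rewrite mulgA mulgVg.
  have idx : inv x * x * (inv x * x) = inv x * x by rewrite mulgA mulVgV.
  rewrite -!mulgA (mulgA y) (mulgA (inv x)) (mulgA (y * _)).
  by rewrite (idem_comm idy idx) !mulgA mulgVg -!mulgA (mulgA y) mulgVg.
have idy : y * inv y * (y * inv y) = y * inv y by rewrite mulgA mulgVg.
have idx : inv x * x * (inv x * x) = inv x * x by rewrite mulgA mulVgV.
rewrite -!mulgA (mulgA y) (mulgA (inv x)) (mulgA (inv x * x)).
by rewrite (idem_comm idx idy) !mulgA mulVgV -!mulgA (mulgA (inv x)) mulVgV.
Qed.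

HB.instance Definition _ := hasInv.Build M inv.
HB.instance Definition _ := Monoid_isStarMonoid.Build M invK invM.
HB.instance Definition _ :=
  isInverseMonoid.Build M mulgVg mulVgV invg_unique.

HB.end.

Section Subsets.
Variable M : inverseMonoidType.
Implicit Types (A B L P X Y : set M) (s t : M).

Definition idempotent s := s * s = s.

Definition natle s t := exists2 e, idempotent e & s = e * t.

Definition up_closed A := forall a s, A a -> natle a s -> A s.

Definition up_closure B : set M := [set s | exists2 b, B b & natle b s].

Definition submonoid A := A 1 /\ forall s t, A s -> A t -> A (s * t).

Definition inverse_submonoid A := submonoid A /\ forall s, A s -> A s^-1.

Definition closed_inverse_submonoid A := inverse_submonoid A /\ up_closed A.

Definition generates X := smallest inverse_submonoid X = [set: M].

Definition closed_fin_gen L :=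
  exists Y, [/\ finite_set Y, Y `<=` L & L = smallest closed_inverse_submonoid Y].

Definition coset L s : set M := up_closure [set l * s | l in L].

Definition cosets L : set (set M) := [set coset L s | s in [set s | L (s * s^-1)]].

Definition finite_index L := finite_set (cosets L).

Definition recognizable P :=
  exists (N : monoidType) (phi : M -> N) (Q : set N),
    [/\ finite_set [set: N], monoid_morphism phi & P = phi @^-1` Q].

(* The empty union is covered by rational_finite. *)
Inductive rational : set M -> Prop :=
| rational_finite A : finite_set A -> rational A
| rational_union A B : rational A -> rational B -> rational (A `|` B)
| rational_product A B : rational A -> rational B ->
    rational [set a * b | a in A & b in B]
| rational_star A : rational A -> rational (smallest submonoid A).

End Subsets.

(* inl x is the letter x and inr x its formal inverse. *)
Definition letter (X : Type) : Type := (X + X)%type.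

Definition letter_inv X (a : letter X) : letter X :=
  match a with inl x => inr x | inr x => inl x end.

Record automaton (A : Type) := Automaton {
  state : finType;
  initial : state;
  step : state -> A -> option state;
  final : set state
}.

Section Automata.
Variables (A : Type) (D : automaton A).

Fixpoint run (s : state D) (w : seq A) : option (state D) :=
  if w is a :: w' then obind (fun t => run t w') (step s a) else Some s.

Definition language : set (seq A) :=
  [set w | exists2 t, run (initial D) w = Some t & final t].

End Automata.

Definition inverse_automaton X (D : automaton (letter X)) :=
  (forall (s t : state D) a,
     step s a = Some t -> step t (letter_inv a) = Some s) /\
  (forall (s1 s2 t : state D) a,
     step s1 a = Some t -> step s2 a = Some t -> s1 = s2).

Section Recognition.
Variables (M : inverseMonoidType) (X : set M).

Definition letter_val (a : letter X) : M :=
  match a with inl x => \val x | inr x => (\val x)^-1 end.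

Definition theta (w : seq (letter X)) : M := \prod_(a <- w) letter_val a.

Definition recognized_by (D : automaton (letter X)) (P : set M) :=
  language D = theta @^-1` P.

Definition inverse_recognized (P : set M) :=
  exists2 D : automaton (letter X), inverse_automaton D & recognized_by D P.

End Recognition.

(* Main.v *)
(* For [A] a subset of [M], the quotient of [A] by [s] is [{x | s x \in A}]; a
   Myhill-Nerode argument shows that [A] is recognizable iff it has finitely
   many quotients. If [L] is a closed inverse submonoid, the quotient by [s] is
   empty unless [s s^-1 \in L], and then it determines and is determined by the
   coset of [s]; moreover the nonempty quotients are the states of an inverse
   automaton recognizing [L]. This gives (a) <-> (b) <-> (c), and (d) follows by
   Kleene's theorem. For (d) -> (e), finite generation is proved by induction on
   rational sets. Both counterexamples live in the inverse monoid of pairs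
   [(a, m)] with [a] in [Z + {-oo, +oo}] and [m] in [Z], a semidirect product of
   a semilattice (under max) by the integers: the trivial submonoid is finite
   but has infinite index, and the set of all idempotents consists of the
   elements above [(+oo, 0)], but is not rational, because a rational set on
   which [m] is constant is finite. *)
From HB Require Import structures.
From mathcomp Require Import all_boot all_order ssralg ssrnum ssrint.
From mathcomp Require Import boolp classical_sets functions cardinality.
From mathcomp Require Import constructive_ereal.
Require Import Defs.

Set Implicit Arguments.
Unset Strict Implicit.
Unset Printing Implicit Defensive.

Import Order.TTheory GRing.Theory Num.Theory.

Local Open Scope classical_set_scope.
Local Open Scope group_scope.

(** On [D], [g] factors through [f], so its image is contained in the image under some [h] of a
    finite set. *)
Lemma finite_image_factor (T U V : Type) (D : set T) (f : T -> U) (g : T -> V) :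
    (forall s t, D s -> D t -> f s = f t -> g s = g t) ->
  finite_set (f @` D) -> finite_set (g @` D).
Proof.
move=> fg finf.
(* An element [s0] of [D] provides a value for [h] outside the image of [f]. *)
have [->|/set0P[s0 Ds0]] := eqVneq D set0; first by rewrite image_set0.
have [u|h hP] := @choice U V (fun u v => forall s, D s -> f s = u -> v = g s).
  have [[s [Ds <-]]|nos] := pselect (exists s, D s /\ f s = u).
    by exists (g s) => t Dt ft; exact: fg.
  by exists (g s0) => t Dt ft; case: nos; exists t.
apply: sub_finite_set (finite_image h finf) => _ [s Ds <-].
by exists (f s); [exists s|exact: hP].
Qed.

(** * Natural order, closed inverse submonoids and cosets *)

Section InverseMonoid.
Variable M : inverseMonoidType.
Implicit Types (e f s t x y : M) (A L Y : set M).

Lemma idempotent_inv e : idempotent e -> e^-1 = e.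
Proof. by move=> ee; apply/esym/invg_unique; rewrite !ee. Qed.

Lemma idempotent_mul e f : idempotent e -> idempotent f -> idempotent (e * f).
Proof.
move=> ee ff; rewrite /idempotent -{3}(mulgVg (e * f)) invgM.
by rewrite !idempotent_inv // !mulgA -(mulgA e f f) ff -(mulgA _ e e) ee.
Qed.

Lemma idempotent_comm e f : idempotent e -> idempotent f -> e * f = f * e.
Proof.
move=> ee ff; rewrite -(idempotent_inv (idempotent_mul ee ff)) invgM.
by rewrite !idempotent_inv.
Qed.

Lemma idempotent1 : idempotent (1 : M).
Proof. exact: mulg1. Qed.

Lemma idempotent_mulgV s : idempotent (s * s^-1).
Proof. by rewrite /idempotent mulgA mulgVg. Qed.

Lemma idempotent_mulVg s : idempotent (s^-1 * s).
Proof. by rewrite /idempotent mulgA mulVgV. Qed.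

Lemma natle_refl s : natle s s.
Proof. by exists 1; [exact: idempotent1 | rewrite mul1g]. Qed.

Lemma natle_trans s t x : natle s t -> natle t x -> natle s x.
Proof.
move=> [e ee ->] [f ff ->]; exists (e * f); last by rewrite mulgA.
exact: idempotent_mul.
Qed.

(** Idempotents commute, so [x * e] equals [(x * e * x^-1) * x], and the conjugate of [e] is again
    idempotent. Hence erasing an idempotent inside a product moves up in the order. *)
Lemma natle_drop_idem x e y : idempotent e -> natle (x * e * y) (x * y).
Proof.
move=> ee; have xeE : x * e * x^-1 * x = x * e.
  rewrite -2!mulgA (idempotent_comm ee (idempotent_mulVg x)).
  by rewrite !mulgA mulgVg.
exists (x * e * x^-1); last by rewrite mulgA xeE.
by rewrite /idempotent !mulgA xeE -(mulgA x e e) ee.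
Qed.

Lemma natle_mul s s' t t' : natle s s' -> natle t t' -> natle (s * t) (s' * t').
Proof.
move=> [e ee ->] [f ff ->]; rewrite mulgA.
apply: natle_trans (natle_drop_idem _ _ ff) _.
by exists e; rewrite ?mulgA.
Qed.

Section ClosedInverseSubmonoid.
Variable L : set M.
Hypothesis Lcl : closed_inverse_submonoid L.

Lemma closed1 : L 1. Proof. by case: Lcl => -[[]]. Qed.
Lemma closedM s t : L s -> L t -> L (s * t).
Proof. by case: Lcl => -[[_ +]] => /(_ s t). Qed.
Lemma closedV s : L s -> L s^-1.
Proof. by case: Lcl => -[_ +] _ => /(_ s). Qed.
Lemma closed_up s t : natle s t -> L s -> L t.
Proof. by case: Lcl => _ + st Ls => /(_ s t); apply. Qed.

Lemma closed_drop_idem x e y : idempotent e -> L (x * e * y) -> L (x * y).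
Proof. by move=> ee; apply: closed_up; exact: natle_drop_idem. Qed.

(** Erase [x * x^-1] from [(s * x) * (s * x)^-1], which lies in [L]. *)
Lemma closed_mulV s x : L (s * x) -> L (s * s^-1).
Proof.
move=> Lsx; apply: (@closed_drop_idem s (x * x^-1)).
  exact: idempotent_mulgV.
by have := closedM Lsx (closedV Lsx); rewrite invgM !mulgA.
Qed.

Lemma coset_eqP s t : L (s * s^-1) -> L (t * t^-1) ->
  coset L s = coset L t <-> L (s * t^-1).
Proof.
move=> Ls Lt; split=> [sEt|Lst].
  have : coset L s s.
    by exists s; [exists 1; [exact: closed1|rewrite mul1g]|exact: natle_refl].
  rewrite sEt => -[_ [l Ll <-] lts].
  apply: closed_up (natle_mul lts (natle_refl t^-1)) _.
  by rewrite -mulgA; exact: closedM.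
have sub x y : L (x * y^-1) -> coset L x `<=` coset L y.
  move=> Lxy z [_ [l Ll <-] lxz]; exists (l * (x * y^-1) * y).
    by exists (l * (x * y^-1)) => //; exact: closedM.
  (* Erasing [y^-1 * y] shows that [l * x * y^-1 * y] lies below [l * x]. *)
  apply: natle_trans lxz; rewrite !mulgA -(mulgA _ y^-1).
  by rewrite -[X in natle X]mulg1 -[X in natle _ X]mulg1;
    apply: natle_drop_idem; exact: idempotent_mulVg.
apply/seteqP; split; apply: sub => //.
by have := closedV Lst; rewrite invgM invgK.
Qed.

End ClosedInverseSubmonoid.

(** * Quotients of a subset *)

Section Quotients.

Definition quotient A s : set M := [set x | A (s * x)].

Lemma quotient1 A : quotient A 1 = A.
Proof. by apply/seteqP; split=> x; rewrite /quotient /= mul1g. Qed.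

Lemma quotientM A s t : quotient A (s * t) = quotient (quotient A s) t.
Proof. by apply/seteqP; split=> x; rewrite /quotient /= mulgA. Qed.

(** The criterion is the one in [coset_eqP], which is how cosets and nonempty quotients come to
    correspond. *)
Lemma quotient_eqP L s t : closed_inverse_submonoid L ->
    L (s * s^-1) -> L (t * t^-1) ->
  quotient L s = quotient L t <-> L (s * t^-1).
Proof.
move=> Lcl Ls Lt; split=> [sEt|Lst].
  by have : quotient L t t^-1 := Lt; rewrite -sEt.
have sub x y : L (x * y^-1) -> quotient L y `<=` quotient L x.
  move=> Lxy z; rewrite /quotient /= => Lyz.
  apply: (closed_drop_idem Lcl (idempotent_mulVg y)).
  by have := closedM Lcl Lxy Lyz; rewrite !mulgA.
apply/seteqP; split; apply: sub => //.
by have := closedV Lcl Lst; rewrite invgM invgK.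
Qed.

Lemma finite_index_quotients L : closed_inverse_submonoid L ->
  finite_index L <-> finite_set (range (quotient L)).
Proof.
move=> Lcl; rewrite /finite_index /cosets.
have eqE s t : L (s * s^-1) -> L (t * t^-1) ->
    coset L s = coset L t <-> quotient L s = quotient L t.
  move=> Ls Lt; apply: iff_trans (coset_eqP Lcl Ls Lt) _.
  exact: iff_sym (quotient_eqP Lcl Ls Lt).
split=> fin.
  have : finite_set (quotient L @` [set s | L (s * s^-1)] `|` [set set0]).
    rewrite finite_setU; split=> //; apply: finite_image_factor fin.
    by move=> s t Ls Lt /(eqE s t Ls Lt).
  apply: sub_finite_set => _ [s _ <-].
  have [Ls|nLs] := pselect (L (s * s^-1)); [by left; exists s|right].
  by apply/seteqP; split=> // x /(closed_mulV Lcl).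
apply: (@finite_image_factor _ _ _ _ (quotient L)).
  by move=> s t Ls Lt /(eqE s t Ls Lt).
by apply: sub_finite_set fin => _ [s _ <-]; exists s.
Qed.

Lemma recognizable_finite_quotients A :
  recognizable A -> finite_set (range (quotient A)).
Proof.
move=> [N [phi [Q [Nfin [_ phiM] ->]]]].
apply: (@finite_image_factor _ _ _ _ phi); last exact: sub_finite_set Nfin.
move=> s t _ _ st.
by apply/seteqP; split=> x; rewrite /quotient /= !phiM st.
Qed.

(** The quotients form the finite carrier of a right action of [M]. As [F] is injective, equalities
    of states can be checked on the sets they stand for. *)
Lemma finite_quotients_action A : finite_set (range (quotient A)) ->
  exists (K : finType) (F : K -> set M) (act : K -> M -> K) (k0 : K),
    [/\ injective F, forall k, exists s, F k = quotient A s,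
        forall k s, F (act k s) = quotient (F k) s & F k0 = A].
Proof.
move=> /finite_seqP[r rE].
have rP (B : set M) : (exists s, B = quotient A s) -> B \in r.
  move=> [s ->]; suff : [set` r] (quotient A s) by [].
  by rewrite -rE; exists s.
have inr (k : seq_sub r) : exists s, val k = quotient A s.
  have : [set` r] (val k) by exact: valP.
  by rewrite -rE => -[s _ <-]; exists s.
have actP (k : seq_sub r) s : quotient (val k) s \in r.
  by have [t ->] := inr k; rewrite -quotientM; apply: rP; exists (t * s).
have k0P : A \in r by apply: rP; exists 1; rewrite quotient1.
exists (seq_sub r), val, (fun k s => SeqSub (actP k s)), (SeqSub k0P).
by split=> //; exact: val_inj.
Qed.

End Quotients.
End InverseMonoid.

(** The full transformation monoid, used as the finite monoid recognizing a set whose quotients are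
    indexed by [K]. *)
Definition endofun (K : finType) := {ffun K -> K}.

Section Endofun.
Variable K : finType.
Implicit Types g h : endofun K.

HB.instance Definition _ := Finite.on (endofun K).

(* Functions act on the right. *)
Definition endofun_mul g h : endofun K := [ffun k => h (g k)].
Definition endofun_one : endofun K := [ffun k => k].

Fact endofun_mulA : associative endofun_mul.
Proof. by move=> g h i; apply/ffunP=> k; rewrite !ffunE. Qed.
Fact endofun_mul1 : left_id endofun_one endofun_mul.
Proof. by move=> g; apply/ffunP=> k; rewrite !ffunE. Qed.
Fact endofun_mulr1 : right_id endofun_one endofun_mul.
Proof. by move=> g; apply/ffunP=> k; rewrite !ffunE. Qed.

HB.instance Definition _ :=
  isMonoid.Build (endofun K) endofun_mulA endofun_mul1 endofun_mulr1.

End Endofun.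

Section FiniteQuotients.
Variables (M : inverseMonoidType) (A : set M).
Hypothesis Afin : finite_set (range (quotient A)).

(** The action is a morphism to transformations of the set of quotients, and [x] lies in [A] iff [1]
    lies in the quotient of [A] by [x]. *)
Lemma finite_quotients_recognizable : recognizable A.
Proof.
have [K [F [act [k0 [Finj _ actE k0E]]]]] := finite_quotients_action Afin.
exists (endofun K), (fun s => [ffun k => act k s] : endofun K).
exists [set g : endofun K | F (g k0) 1].
split.
- exact: finite_finset.
- split; first by apply/ffunP => k; apply: Finj; rewrite !ffunE actE quotient1.
  by move=> s t; apply/ffunP => k; apply: Finj; rewrite !ffunE !actE quotientM.
- by apply/seteqP; split=> x; rewrite /= ffunE actE k0E /quotient /= mulg1.
Qed.

End FiniteQuotients.

(** * Words and inverse automata *)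

Section Recognition.
Variables (M : inverseMonoidType) (X : set M).
Implicit Types (u v w : seq (letter X)) (L : set M).

Lemma theta_cat u v : theta (u ++ v) = theta u * theta v.
Proof. exact: big_cat. Qed.

Lemma letter_val_inv (a : letter X) :
  letter_val (letter_inv a) = (letter_val a)^-1.
Proof. by case: a => x //=; rewrite invgK. Qed.

Lemma theta_surj : generates X -> forall s, exists w, @theta M X w = s.
Proof.
move=> genX s; suff : smallest (@inverse_submonoid M) X `<=` range (@theta M X).
  by rewrite genX => /(_ s I)[w _ <-]; exists w.
apply: smallest_sub; last first.
  move=> x Xx; exists [:: inl (SigSub (mem_set Xx))] => //.
  by rewrite /theta big_seq1.
split; first split.
- by exists [::] => //; exact: big_nil.
- by move=> _ _ [u _ <-] [v _ <-]; exists (u ++ v); rewrite ?theta_cat.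
- move=> _ [w _ <-]; exists (rev (map (@letter_inv X) w)) => //.
  elim: w => [|a w IHw]; first by rewrite /theta !big_nil invg1.
  rewrite /= rev_cons -cats1 theta_cat IHw /theta big_seq1 big_cons invgM.
  by rewrite letter_val_inv.
Qed.

Lemma run_cat (B : Type) (D : automaton B) (k : state D) (u v : seq B) :
  run k (u ++ v) = obind (fun l => run l v) (run k u).
Proof. by elim: u k => //= b u IHu k; case: (step k b). Qed.

(** The quotient by [theta w] depends only on the outcome of reading [w] from the initial state. *)
Lemma automaton_finite_quotients (D : automaton (letter X)) (P : set M) :
  generates X -> recognized_by D P -> finite_set (range (quotient P)).
Proof.
move=> genX DP.
have -> : range (quotient P) = range (fun w => quotient P (theta w)).
  apply/seteqP; split=> _ [s _ <-]; last by exists (theta s).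
  by have [w <-] := theta_surj genX s; exists w.
have memP w : P (theta w) = language D w by rewrite DP.
apply: (@finite_image_factor _ _ _ _ (run (initial D))); last first.
  exact: finite_finset.
move=> u v _ _ uv; apply/seteqP; split=> x; have [w <-] := theta_surj genX x.
  by rewrite /quotient /= -!theta_cat !memP /language /= !run_cat uv.
by rewrite /quotient /= -!theta_cat !memP /language /= !run_cat uv.
Qed.

Lemma finite_quotients_automaton L :
    closed_inverse_submonoid L -> finite_set (range (quotient L)) ->
  inverse_recognized X L.
Proof.
move=> Lcl /finite_quotients_action[K [F [act [k0 [Finj Fq actE k0E]]]]].
(* Moves into the empty quotient are left undefined: they could not be reversed. *)
pose stp k (a : letter X) :=
  let l := act k (letter_val a) in if `[< F l !=set0 >] then Some l else None.
have stpP k l a : stp k a = Some l -> l = act k (letter_val a) /\ F l !=set0.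
  by rewrite /stp; case: asboolP => // Fl [<-].
(* Nonemptiness puts [(s * a) * (s * a)^-1] in [L], so [quotient_eqP] applies to [s * a * a^-1] and
   [s]. *)
have qV s a : quotient L (s * a) !=set0 ->
    quotient L (s * a * a^-1) = quotient L s.
  move=> [x /(closed_mulV Lcl)]; rewrite invgM !mulgA => Lsa.
  apply/(quotient_eqP Lcl) => //.
    by apply: (closed_mulV Lcl (x := s^-1)).
  by apply: (closed_mulV Lcl (x := a * a^-1 * s^-1)); rewrite !mulgA.
have actV k a : F (act k a) !=set0 -> act (act k a) a^-1 = k.
  have [s Fk] := Fq k; rewrite actE Fk -quotientM => ne.
  by apply: Finj; rewrite !actE Fk -!quotientM mulgA; exact: qV.
have neV k a : F (act k a) !=set0 -> F k !=set0.
  by rewrite actE => -[x Fx]; exists (a * x).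
exists (Automaton k0 stp [set k | F k 1]).
  split=> [k l a /stpP[-> ne]|k1 k2 l a /stpP[l1 ne] /stpP[l2 _]] /=.
    rewrite /stp letter_val_inv actV //; case: asboolP => // -[].
    exact: neV ne.
  by rewrite -(actV k1 (letter_val a)) -?l1 // l2 actV // -l2.
have actM k s t : act k (s * t) = act (act k s) t.
  by apply: Finj; rewrite !actE quotientM.
have act1 k : act k 1 = k by apply: Finj; rewrite actE quotient1.
have runP w k l : @run _ (Automaton k0 stp [set k | F k 1]) k w = Some l ->
    l = act k (theta w).
  elim: w k => [|a w IHw] k /=; first by case=> <-; rewrite /theta big_nil act1.
  rewrite /theta big_cons actM; case E: (stp k a) => [m|] //= /IHw ->.
  by have [-> _] := stpP _ _ _ E.
(* If the last quotient is nonempty, so are all earlier ones by [neV]; the run is never blocked. *)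
have runE w k : F (act k (theta w)) !=set0 ->
    @run _ (Automaton k0 stp [set k | F k 1]) k w = Some (act k (theta w)).
  elim: w k => [|a w IHw] k; first by rewrite /theta big_nil act1.
  rewrite /theta big_cons actM => ne /=.
  by rewrite /stp; case: asboolP => [_|[]] /=; [exact: IHw|exact: neV ne].
have FE w : F (act k0 (theta w)) 1 = L (theta w).
  by rewrite actE k0E /quotient /= mulg1.
apply/seteqP; split=> w /=.
  by rewrite /language => -[l /runP -> /=]; rewrite FE.
rewrite /language -FE => Fw.
by exists (act k0 (theta w)) => //; apply: runE; exists 1.
Qed.

End Recognition.

(** * Kleene's theorem for a finite action *)

Section Kleene.
Variables (M : inverseMonoidType) (K : finType) (act : K -> M -> K) (G : set M).
Hypothesis Gfin : finite_set G.
Implicit Types (i j k : K) (U : seq K) (s t : M).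

(* Labels of nonempty paths from [i] to [j] all of whose interior vertices lie
   in [U]. *)
Inductive path_label U j : K -> M -> Prop :=
| path_edge i s of G s & act i s = j : path_label U j i s
| path_cons i s t of G s & act i s \in U & path_label U j (act i s) t :
    path_label U j i (s * t).

Lemma path_label_cat U i j k s t : k \in U ->
  path_label U k i s -> path_label U j k t -> path_label U j i (s * t).
Proof.
move=> kU + kj; elim=> [{}i {}s Gs sk|{}i {}s u Gs sU _ IHu].
  by apply: path_cons => //; rewrite sk.
by rewrite -mulgA; apply: path_cons.
Qed.

Lemma path_label_sub U k i j s :
  path_label U j i s -> path_label (k :: U) j i s.
Proof.
elim=> [{}i {}s Gs sj|{}i {}s u Gs sU _ IHu]; first exact: path_edge.
by apply: path_cons => //; rewrite inE sU orbT.
Qed.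

Let path_set U i j : set M := path_label U j i.

(** A path through [k] is cut at its visits to [k]: a segment up to the first visit, a product of
    loops, and a segment after the last visit. *)
Lemma path_label_consE U k i j : path_set (k :: U) i j =
  path_set U i j `|` [set s * t | s in [set s * t | s in path_set U i k
    & t in smallest (@submonoid M) (path_set U k k)] & t in path_set U k j].
Proof.
set S := smallest _ _.
have S1 : S 1 by move=> A [[A1 _] _].
have SM s t : S s -> S t -> S (s * t).
  by move=> Ss St A AP; apply: AP.1.2; [exact: Ss | exact: St].
have Ssub s : path_set U k k s -> S s by move=> ks A [_]; apply.
apply/seteqP; split=> s.
  elim=> [{}i {}s Gs sj|{}i {}s t Gs + _ IH]; first by left; exact: path_edge.
  have [sk _|sk] := eqVneq (act i s) k; last first.
    rewrite inE (negPf sk) /= => sU.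
    case: IH => [it|]; first by left; exact: path_cons.
    move=> [_ [u iu [v Sv <-]] [w kw <-]]; right.
    exists (s * u * v); last by exists w; rewrite ?mulgA.
    by exists (s * u); [exact: path_cons | exists v].
  (* The first edge reaches [k], so it is the whole first segment; the first segment of the
     decomposition of the rest becomes a loop. *)
  have ik : path_set U i k s by exact: path_edge.
  right; rewrite sk in IH; case: IH => [kt|[_ [u ku [v Sv <-]] [w kw <-]]].
    by exists s; [exists s => //; exists 1; rewrite ?mulg1 | exists t].
  exists (s * (u * v)); last by exists w; rewrite ?mulgA.
  by exists s => //; exists (u * v) => //; apply: SM => //; exact: Ssub.
move=> [|[_ [u iu [v Sv <-]] [w kw <-]]]; first exact: path_label_sub.
rewrite -mulgA; apply: (@path_label_cat _ _ _ k); rewrite ?inE ?eqxx //.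
  exact: path_label_sub.
(* The elements that can be prefixed to every path from [k] to [j] form a submonoid containing the
   loops, hence all their products. *)
pose A : set M := [set v | forall w,
  path_set (k :: U) k j w -> path_set (k :: U) k j (v * w)].
suff : A v by apply; exact: path_label_sub.
apply: Sv; split; first split=> [t|s' t' As At t kt]; first by rewrite mul1g.
  by rewrite -mulgA; apply: As; exact: At.
move=> t kt x kx; apply: (@path_label_cat _ _ _ k) kx; rewrite ?inE ?eqxx //.
exact: path_label_sub.
Qed.

Lemma rational_path_label U i j : rational (path_set U i j).
Proof.
elim: U i j => [|k U IHU] i j.
  by apply: rational_finite; apply: sub_finite_set Gfin => s; case.
rewrite path_label_consE; apply: rational_union => //.
by do 2![apply: rational_product => //]; exact: rational_star.
Qed.

Hypothesis act1 : forall k, act k 1 = k.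
Hypothesis actM : forall k s t, act k (s * t) = act (act k s) t.
Hypothesis Gind : forall P : M -> Prop, P 1 ->
  (forall g s, G g -> P s -> P (g * s)) -> forall s, P s.

(** With all of [K] allowed as interior vertices, paths are unrestricted; the empty path, which
    [path_label] excludes, contributes [1] when [i = j]. *)
Lemma rational_action i j : rational [set s | act i s = j].
Proof.
have -> : [set s | act i s = j] =
    path_set (enum K) i j `|` [set s | s = 1 /\ i = j].
  apply/seteqP; split=> s; last first.
    case=> [|[-> <-]]; last exact: act1.
    elim=> // {}i {}s t Gs _ _ IH /=; rewrite actM; exact: IH.
  move=> /=; elim/Gind: s i => [|g s Gg IHs] i.
    by rewrite act1; right.
  rewrite actM => /IHs[|[-> gj]]; left; last by rewrite mulg1; exact: path_edge.
  by apply: path_cons; rewrite ?mem_enum.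
apply: rational_union; first exact: rational_path_label.
by apply: rational_finite; apply: sub_finite_set (finite_set1 1) => s [->].
Qed.

End Kleene.

(** * From recognizable to rational, and from rational to finitely generated *)

Section MainImplications.
Variables (M : inverseMonoidType).
Implicit Types (X L R Y : set M) (p q s t : M).

Lemma rational_bigcup (I : eqType) (r : seq I) (F : I -> set M) :
  (forall i, rational (F i)) -> rational [set s | exists2 i, i \in r & F i s].
Proof.
move=> Frat; elim: r => [|i r IHr].
  by apply: rational_finite; apply: sub_finite_set (finite_set0 _) => s [].
have -> : [set s | exists2 j, j \in i :: r & F j s] =
    F i `|` [set s | exists2 j, j \in r & F j s].
  apply/seteqP; split=> s.
    by move=> [j]; rewrite inE => /predU1P[->|jr Fs]; [left | right; exists j].
  move=> [Fs|[j jr Fs]]; first by exists i; rewrite ?inE ?eqxx.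
  by exists j; rewrite // inE jr orbT.
exact: rational_union.
Qed.

(** [R] is the union, over the states whose quotient contains [1], of the sets of elements carrying
    [k0] to that state. *)
Lemma recognizable_rational X R :
  finite_set X -> generates X -> recognizable R -> rational R.
Proof.
move=> Xfin genX /recognizable_finite_quotients/finite_quotients_action.
move=> [K [F [act [k0 [Finj _ actE k0E]]]]].
pose G : set M := X `|` [set x^-1 | x in X].
have Gfin : finite_set G.
  by rewrite finite_setU; split=> //; exact: finite_image.
have act1 k : act k 1 = k by apply: Finj; rewrite actE quotient1.
have actM k s t : act k (s * t) = act (act k s) t.
  by apply: Finj; rewrite !actE quotientM.
have Gind (P : M -> Prop) : P 1 ->
    (forall g s, G g -> P s -> P (g * s)) -> forall s, P s.
  move=> P1 PM s; have [w <-] := theta_surj genX s.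
  elim: w => [|a w IHw]; first by rewrite /theta big_nil.
  rewrite /theta big_cons; apply: PM IHw.
  case: a => x; [left | right; exists (\val x) => //];
    exact: set_mem (valP x).
have -> : R = [set s | exists2 k, k \in [seq k <- enum K | `[< F k 1 >]] &
                         act k0 s = k].
  apply/seteqP; split=> s; have <- : F (act k0 s) 1 = R s.
  - by rewrite actE k0E /quotient /= mulg1.
  - move=> Fs; exists (act k0 s) => //.
    by rewrite mem_filter mem_enum andbT; apply/asboolP.
  - by rewrite actE k0E /quotient /= mulg1.
  - by move=> [k]; rewrite mem_filter => /andP[/asboolP Fk _] ->.
apply: rational_bigcup => k; exact: (rational_action Gfin).
Qed.

Local Notation closed_span := (smallest (@closed_inverse_submonoid M)).

Lemma closed_span_closed Y : closed_inverse_submonoid (closed_span Y).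
Proof.
split; first split; first split.
- by move=> L [Lcl _]; exact: closed1.
- by move=> s t Ys Yt L LY; exact: (closedM (proj1 LY) (Ys L LY) (Yt L LY)).
- by move=> s Ys L LY; exact: (closedV (proj1 LY) (Ys L LY)).
- by move=> s t Ys st L LY; exact: (closed_up (proj1 LY) st (Ys L LY)).
Qed.

Lemma closed_spanS Y Z : Y `<=` Z -> closed_span Y `<=` closed_span Z.
Proof. by apply: sub_smallest2r; exact: closed_span_closed. Qed.

(* The translates by [p] and [q] make the statement inductive: for a product
   [R R'], fix [r] in [R] and [r'] in [R'] and use
   [p s s' q >= (p s r' q) (p r r' q)^-1 (p r s' q)]; for a star, use
   [p s_1 ... s_n q >= (p s_1 q) (p q)^-1 (p s_2 q) ... (p q)^-1 (p s_n q)]. *)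
Lemma rational_closed_span R L p q :
    rational R -> closed_inverse_submonoid L ->
    (forall s, R s -> L (p * s * q)) ->
  exists Y, [/\ finite_set Y, Y `<=` L &
    forall s, R s -> closed_span Y (p * s * q)].
Proof.
move=> Rrat Lcl; have spanP := closed_span_closed.
elim: Rrat p q => {R} [R Rfin|R S _ IHR _ IHS|R S _ IHR _ IHS|R _ IHR] p q RL.
- exists [set p * s * q | s in R]; split; first exact: finite_image.
    by move=> _ [s Rs <-]; exact: RL.
  by move=> s Rs; apply: sub_gen_smallest; exists s.
- have [|Y [Yfin YL YP]] := IHR p q; first by move=> s Rs; apply: RL; left.
  have [|Z [Zfin ZL ZP]] := IHS p q; first by move=> s Ss; apply: RL; right.
  exists (Y `|` Z); split; [by rewrite finite_setU | by move=> s [/YL|/ZL] |].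
  by move=> s [/YP|/ZP]; apply: closed_spanS => t; [left | right].
- have [[[r Rr] [r' Sr']]|none] := pselect (R !=set0 /\ S !=set0); last first.
    exists set0; split=> //.
    by move=> _ [s Rs [t St <-]]; case: none; split; [exists s | exists t].
  have RSL s t : R s -> S t -> L (p * s * t * q).
    by move=> Rs St; rewrite -(mulgA p); apply: RL; exists s => //; exists t.
  have [|Y [Yfin YL YP]] := IHR p (r' * q).
    by move=> s Rs; rewrite mulgA; exact: RSL.
  have [|Z [Zfin ZL ZP]] := IHS (p * r) q; first by move=> s; exact: RSL.
  exists (Y `|` Z); split; [by rewrite finite_setU | by move=> s [/YL|/ZL] |].
  have YZ := spanP (Y `|` Z).
  have YU : closed_span Y `<=` closed_span (Y `|` Z).
    by apply: closed_spanS; left.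
  have ZU : closed_span Z `<=` closed_span (Y `|` Z).
    by apply: closed_spanS; right.
  move=> _ [s Rs [t St <-]].
  have := closedM YZ (closedM YZ (YU _ (YP _ Rs)) (closedV YZ (YU _ (YP _ Rr))))
                     (ZU _ (ZP _ St)).
  (* The glued product is [p * s * t * q] with the idempotents [e] and [f] inserted; both are
     erased. *)
  set e := r' * q * (r' * q)^-1; set f := (p * r)^-1 * (p * r).
  have -> : p * s * (r' * q) * (p * r * (r' * q))^-1 * (p * r * t * q) =
      p * s * e * (f * (t * q)) by rewrite invgM !mulgA.
  move/(closed_drop_idem YZ (idempotent_mulgV _)); rewrite (mulgA (p * s)).
  move/(closed_drop_idem YZ (idempotent_mulVg _)).
  by rewrite !mulgA.
- set S := smallest _ _ in RL *.
  have S1 : S 1 by move=> A [[A1 _] _].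
  have RS : R `<=` S by exact: sub_gen_smallest.
  have [|Y [Yfin YL YP]] := IHR p q; first by move=> s /RS; exact: RL.
  (* The connecting element [p * q] lies in [L] because the star contains [1]. *)
  exists (Y `|` [set p * q]); split.
  + by rewrite finite_setU; split=> //; exact: finite_set1.
  + by move=> s [/YL //|->]; rewrite -(mulg1 p); exact: RL.
  set Z := Y `|` _; have Zcl := spanP Z.
  have Zpq : closed_span Z (p * q) by apply: sub_gen_smallest; right.
  suff : S `<=` [set s | closed_span Z (p * s * q)] by apply.
  apply: smallest_sub; last first.
    by move=> s /YP; apply: closed_spanS; left.
  split=> [|s t /= Zs Zt]; first by rewrite /= mulg1.
  have := closedM Zcl (closedM Zcl Zs (closedV Zcl Zpq)) Zt.
  have -> : p * s * q * (p * q)^-1 * (p * t * q) =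
      p * s * (q * q^-1) * (p^-1 * p * (t * q)) by rewrite invgM !mulgA.
  move/(closed_drop_idem Zcl (idempotent_mulgV _)); rewrite (mulgA (p * s)).
  move/(closed_drop_idem Zcl (idempotent_mulVg _)).
  by rewrite !mulgA.
Qed.

Lemma rational_closed_fin_gen L :
  closed_inverse_submonoid L -> rational L -> closed_fin_gen L.
Proof.
move=> Lcl Lrat.
have [|Y [Yfin YL LY]] := @rational_closed_span L L 1 1 Lrat Lcl.
  by move=> s; rewrite mul1g mulg1.
exists Y; split=> //; apply/seteqP; split; last exact: smallest_sub.
by move=> s /LY; rewrite mul1g mulg1.
Qed.

(** Since idempotents commute and square to themselves, adjoining [e] to [T] adds only the multiples
    [e * t]. *)
Lemma finite_idempotent_submonoid (r : seq M) :
    (forall e, e \in r -> idempotent e) ->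
  exists T : set M, [/\ finite_set T, submonoid T, [set` r] `<=` T &
    T `<=` @idempotent M].
Proof.
elim: r => [|e r IHr] rE.
  exists [set 1]; split=> //.
    by split=> // _ _ -> ->; rewrite mulg1.
  by move=> _ ->; exact: idempotent1.
have ee : idempotent e by apply: rE; rewrite inE eqxx.
have [|T [Tfin [T1 TM] rT TE]] := IHr.
  by move=> f fr; apply: rE; rewrite inE fr orbT.
exists (T `|` [set e * t | t in T]); split.
- by rewrite finite_setU; split=> //; exact: finite_image.
- split=> [|s t]; first by left.
  have comm u : T u -> u * e = e * u by move=> /TE uE; exact: idempotent_comm.
  move=> [Ts|[u Tu <-]] [Tt|[v Tv <-]].
  + by left; exact: TM.
  + by right; exists (s * v); [exact: TM | rewrite !mulgA comm].
  + by right; exists (u * t); [exact: TM | rewrite mulgA].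
  + right; exists (u * v); first exact: TM.
    by rewrite !mulgA -(mulgA e u e) comm // mulgA ee.
- move=> f /=; rewrite inE => /predU1P[->|fr]; last by left; exact: rT.
  by right; exists 1; rewrite ?mulg1.
- by move=> s [/TE //|[t Tt <-]]; apply: idempotent_mul => //; exact: TE.
Qed.

(** Induction on [R]. In a product, fixing one factor and cancelling in [H] makes [g] constant on
    the other. A star contains [1], so [g] vanishes on it; its generators are then finitely many
    idempotents, which generate a finite submonoid. *)
Lemma rational_constant_finite (H : zmodType) (g : M -> H) R :
    g 1 = 0%R -> {morph g : s t / s * t >-> (s + t)%R} ->
    (forall s, g s = 0%R -> idempotent s) ->
    rational R -> (forall s t, R s -> R t -> g s = g t) -> finite_set R.
Proof.
move=> g1 gM gE; elim=> {R} [//|R S _ IHR _ IHS|R S _ IHR _ IHS|R _ IHR] cst.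
- rewrite finite_setU; split.
    by apply: IHR => s t Rs Rt; apply: cst; left.
  by apply: IHS => s t Ss St; apply: cst; right.
- have [[[r Rr] [r' Sr']]|none] := pselect (R !=set0 /\ S !=set0); last first.
    apply: sub_finite_set (finite_set0 _) => _ [s Rs [t St <-]].
    by apply: none; split; [exists s | exists t].
  apply: finite_image2.
    apply: IHR => s t Rs Rt; apply: (addIr (g r')); rewrite -!gM.
    by apply: cst; [exists s => //; exists r' | exists t => //; exists r'].
  apply: IHS => s t Ss St; apply: (addrI (g r)); rewrite -!gM.
  by apply: cst; exists r => //; [exists s | exists t].
- set S := smallest _ _ in cst *.
  have S1 : S 1 by move=> A [[A1 _] _].
  have RS : R `<=` S by exact: sub_gen_smallest.
  have RE s : R s -> idempotent s.
    by move=> /RS Ss; apply: gE; rewrite -g1; exact: cst.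
  have /finite_seqP[r rE] : finite_set R.
    by apply: IHR => s t /RS Ss /RS St; exact: cst.
  have [e er|T [Tfin Tsub rT _]] := @finite_idempotent_submonoid r.
    by apply: RE; rewrite rE.
  by apply: sub_finite_set Tfin; apply: smallest_sub; rewrite // rE.
Qed.

End MainImplications.

(* The pair [(a, m)] stands for the translation by [m] of the integers, with
   image cut down to the integers above [a]; the shift [m] is remembered even
   when the image is empty ([a = +oo]). *)
Definition translation : Type := (\bar int * int)%type.

HB.instance Definition _ := Choice.on translation.

(** * The inverse monoid of translations *)

Section Translation.
Local Open Scope ereal_scope.
Implicit Types x y z : translation.

(** Composition with [y] applied first: its image is shifted by [x.2], then cut down at [x.1]. *)
Definition translation_mul x y : translation :=
  (maxe x.1 (y.1 + x.2%:E), (x.2 + y.2)%R).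
Definition translation_one : translation := (-oo, 0%R).
Definition translation_inv x : translation := (x.1 - x.2%:E, (- x.2)%R).

Fact translation_mulA : associative translation_mul.
Proof.
move=> x y z; rewrite /translation_mul /= adde_maxl maxA addrA.
by rewrite EFinD -addeA [y.2%:E + _]addeC.
Qed.

Fact translation_mul1 : left_id translation_one translation_mul.
Proof.
by move=> [a m]; rewrite /translation_mul /= maxNye adde0 add0r.
Qed.

Fact translation_mulr1 : right_id translation_one translation_mul.
Proof.
by move=> [a m]; rewrite /translation_mul /= addNye maxeNy addr0.
Qed.

HB.instance Definition _ := isMonoid.Build translation
  translation_mulA translation_mul1 translation_mulr1.

Lemma translation_mulV x :
  translation_mul x (translation_inv x) = (x.1, 0%R).
Proof.
by rewrite /translation_mul /= -addeA -EFinD addNr adde0 maxxx subrr.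
Qed.

Fact translation_mulgVg x :
  translation_mul (translation_mul x (translation_inv x)) x = x.
Proof.
case: x => a m.
by rewrite translation_mulV /translation_mul /= adde0 maxxx add0r.
Qed.

Fact translation_mulVgV x :
  translation_mul (translation_mul (translation_inv x) x) (translation_inv x)
    = translation_inv x.
Proof.
by rewrite -translation_mulA translation_mulV /translation_mul /= maxxx addr0.
Qed.

Fact translation_inv_unique x y :
    translation_mul (translation_mul x y) x = x ->
    translation_mul (translation_mul y x) y = y ->
  y = translation_inv x.
Proof.
case: x y => a m [b n]; rewrite /translation_mul /translation_inv /=.
move=> [aE mE] [bE _].
have nE : n = (- m)%R.
  by apply: (addrI m); rewrite subrr; apply: (addIr m); rewrite mE add0r.
(* The first identity gives [b + m <= a], the second [a - m <= b]. *)
rewrite nE in aE bE *; congr pair; apply/eqP; rewrite eq_le; apply/andP; split.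
  have le_ba : b + m%:E <= a by rewrite -[leRHS]aE !le_max lexx orbT.
  have := leeD2r (- m)%:E le_ba.
  by rewrite -addeA -EFinD subrr adde0.
by rewrite -[leRHS]bE !le_max lexx orbT.
Qed.

HB.instance Definition _ := Monoid_isInverseMonoid.Build translation
  translation_mulgVg translation_mulVgV translation_inv_unique.
End Translation.

(** * The two counterexamples *)

Section TranslationSubmonoids.
Implicit Types s t : translation.

Definition trans (a : \bar int) (m : int) : translation := (a, m).
Arguments trans a m /.

Lemma translation_mulE s t :
  s * t = (maxe s.1 (t.1 + s.2%:E)%E, (s.2 + t.2)%R) :> translation.
Proof. by []. Qed.

Lemma translation_oneE : 1 = trans -oo%E 0%R :> translation.
Proof. by []. Qed.

Lemma translation_invE s : s^-1 = ((s.1 - s.2%:E)%E, (- s.2)%R) :> translation.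
Proof. by []. Qed.

Lemma translation_idempotent s : idempotent s <-> s.2 = 0%R.
Proof.
case: s => a m; rewrite /idempotent translation_mulE /=.
split=> [[_ mE]|->]; last by rewrite adde0 maxxx addr0.
by apply: (addrI m); rewrite addr0.
Qed.

Definition translation_generators : set translation :=
  [set trans -oo%E 1%R; trans 0%E 0%R; trans +oo%E 0%R].

(** An element [(a, m)] is [(a, 0)] times the shift [(-oo, m)]. Shifts come from the unit shift and
    its inverse, and they conjugate [(0, 0)] to [(k, 0)] for every integer [k]. *)
Lemma translation_generators_generate : generates translation_generators.
Proof.
apply/seteqP; split=> // -[a m] _ A [[[A1 AM] AV] AX].
have A_unit (n : int) : A (trans -oo%E n).
  have Anat (k : nat) : A (trans -oo%E (Posz k)).
    elim: k => [|k IHk]; first exact: A1.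
    have -> : trans -oo%E (Posz k.+1) = trans -oo%E 1%R * trans -oo%E (Posz k).
      by rewrite translation_mulE /= maxxx intS.
    by apply: AM => //; apply: AX; left; left.
  case: n => // n; have := AV _ (Anat n.+1).
  by rewrite translation_invE /= NegzE.
have A_idem : A (trans a 0%R).
  case: a => [k||]; last exact: A1.
    have -> : trans k%:E%E 0%R =
        trans -oo%E k * trans 0%E 0%R * trans -oo%E (- k)%R.
      by rewrite !translation_mulE /= maxNye add0e addr0 maxeNy subrr.
    by do 2!apply: (AM) => //; apply: AX; left; right.
  by apply: AX; right.
have := AM _ _ A_idem (A_unit m).
by rewrite translation_mulE /= maxeNy add0r.
Qed.

Lemma translation_not_finite_quotients :
  ~ finite_set (range (@quotient translation [set 1])).
Proof.
move=> fin; apply: infinite_nat; rewrite -[setT]image_id.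
apply: (@finite_image_factor _ _ _ _
          (fun n : nat => quotient [set 1] (trans -oo%E (Posz n)))).
  move=> m n _ _ mn.
  (* The inverse shift lies in the quotient and determines [m]. *)
  have : quotient [set 1] (trans -oo%E (Posz m)) (trans -oo%E (- Posz m)%R).
    by rewrite /quotient /= translation_mulE /= maxxx subrr.
  rewrite mn /quotient /= translation_mulE translation_oneE => -[/eqP].
  by rewrite subr_eq0 => /eqP[].
by apply: sub_finite_set fin => _ [n _ <-]; exists (trans -oo%E (Posz n)).
Qed.

Definition translation_idempotents : set translation := [set s | s.2 = 0%R].

Lemma translation_idempotents_closed :
  closed_inverse_submonoid translation_idempotents.
Proof.
split; first split; first split=> //.
- move=> s t; rewrite /translation_idempotents /= => -> ->.
  exact: addr0.
- by move=> s; rewrite /translation_idempotents /= => ->; rewrite oppr0.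
- move=> s t; rewrite /translation_idempotents /= => s0 [e].
  by move=> /translation_idempotent e0 sE; rewrite sE /= e0 add0r in s0.
Qed.

(** The idempotent [(+oo, 0)] lies below all the others. *)
Lemma translation_idempotents_fin_gen :
  closed_fin_gen translation_idempotents.
Proof.
exists [set trans +oo%E 0%R]; split; first exact: finite_set1.
  by move=> _ ->.
apply/seteqP; split; last first.
  apply: smallest_sub; first exact: translation_idempotents_closed.
  by move=> _ ->.
move=> [a m]; rewrite /translation_idempotents /= => -> L [Lcl Ly].
apply: (closed_up Lcl) (Ly _ erefl).
exists (trans +oo%E 0%R); first exact/translation_idempotent.
by rewrite translation_mulE /= maxye addr0.
Qed.

(** The second component is a morphism to the integers that is constant on this infinite set, so
    [rational_constant_finite] excludes rationality. *)
Lemma translation_idempotents_not_rational : ~ rational translation_idempotents.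
Proof.
move=> rat; apply: infinite_nat; rewrite -[setT]image_id.
apply: (@finite_image_factor _ _ _ _
          (fun n : nat => trans (Posz n)%:E%E 0%R)).
  by move=> m n _ _ [].
apply: (@sub_finite_set _ _ translation_idempotents).
  by move=> _ [n _ <-].
apply: (@rational_constant_finite translation int (fun s => s.2)) => //.
  by move=> s /translation_idempotent.
by move=> s t -> ->.
Qed.

End TranslationSubmonoids.

(** The identity is maximal: [1 = e * s] gives [e = e * e * s = e * s = 1]. *)
Lemma closed_inverse_submonoid1 (M : inverseMonoidType) :
  closed_inverse_submonoid [set 1 : M].
Proof.
split; first split; first split=> //.
- by move=> _ _ -> ->; exact: mulg1.
- by move=> _ ->; exact: invg1.
- move=> _ s -> [e ee es]; suff e1 : e = 1 by rewrite e1 mul1g in es.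
  by rewrite -[e]mulg1 es mulgA ee.
Qed.

(** * Assembling the implications and the counterexamples *)

Theorem theorem4p1 :
  (forall (M : inverseMonoidType) (X L : set M),
     finite_set X -> generates X -> closed_inverse_submonoid L ->
     [/\ inverse_recognized X L <-> finite_index L,
         finite_index L <-> recognizable L,
         [\/ inverse_recognized X L, finite_index L | recognizable L] ->
           rational L
       & rational L -> closed_fin_gen L]) /\
  (exists (M : inverseMonoidType) (X L : set M),
     [/\ finite_set X, generates X & closed_inverse_submonoid L] /\
     [/\ rational L, ~ inverse_recognized X L, ~ finite_index L
       & ~ recognizable L]) /\
  (exists (M : inverseMonoidType) (X L : set M),
     [/\ finite_set X, generates X & closed_inverse_submonoid L] /\
     closed_fin_gen L /\ ~ rational L).
Proof.
have recP (M : inverseMonoidType) (L : set M) :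
    recognizable L <-> finite_set (range (quotient L)).
  split; first exact: recognizable_finite_quotients.
  exact: finite_quotients_recognizable.
have autP (M : inverseMonoidType) (X L : set M) : generates X ->
    closed_inverse_submonoid L ->
    inverse_recognized X L <-> finite_set (range (quotient L)).
  move=> genX Lcl; split; last exact: finite_quotients_automaton.
  by move=> [D _]; exact: automaton_finite_quotients.
have Xfin : finite_set translation_generators by exact: finite_set3.
have genX := translation_generators_generate.
split; [|split].
- move=> M X L {}Xfin {}genX Lcl; have idxP := finite_index_quotients Lcl.
  split.
  + exact: iff_trans (autP _ _ _ genX Lcl) (iff_sym idxP).
  + exact: iff_trans idxP (iff_sym (recP _ _)).
  + move=> LP; apply: (recognizable_rational Xfin genX); apply/recP.
    case: LP => [autL|/idxP //|/recP //].
    exact: (proj1 (autP _ _ _ genX Lcl) autL).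
  + exact: rational_closed_fin_gen.
- have Lcl := @closed_inverse_submonoid1 translation.
  have nfin := translation_not_finite_quotients.
  exists translation, translation_generators, [set 1]; split=> //.
  split.
  + exact/rational_finite/finite_set1.
  + by rewrite autP.
  + by rewrite finite_index_quotients.
  + by rewrite recP.
- exists translation, translation_generators, translation_idempotents; split.
    by split=> //; exact: translation_idempotents_closed.
  split; first exact: translation_idempotents_fin_gen.
  exact: translation_idempotents_not_rational.
Qed.
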